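(* For every integer $n \ge 4$, $\chi_{la}(C_n \circ K_1) = n+2$, where $C_n$ is the cycle on $n$ vertices.
   Context: Let $G=(V,E)$ be a finite simple undirected graph with no component isomorphic to $K_2$. A bijection $f : E \to \{1,2,\dots,|E|\}$ is a local antimagic labeling of $G$ if $w(u)\ne w(v)$ for every pair of adjacent vertices $u,v$, where $w(u)=\sum_{e\in E(u)} f(e)$ and $E(u)$ is the set of edges incident to $u$. Such an $f$ induces the proper vertex coloring $v\mapsto w(v)$, which uses $|\{w(v): v\in V\}|$ colors. The local antimagic chromatic number $\chi_{la}(G)$ is the minimum number of colors used over all colorings induced by local antimagic labelings of $G$ (so $\chi_{la}(G)\le k$ means that there is a local antimagic labeling inducing at most $k$ colors). The corona product $G\circ H$ is obtained from one copy of $G$ and $|V(G)|$ copies of $H$ by joining the $i$-th vertex of $G$ to every vertex of the $i$-th copy of $H$, for $1\le i\le |V(G)|$. *)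

(* Defs.v *)
From mathcomp Require Import all_boot.
Set Implicit Arguments.
Unset Strict Implicit.
Unset Printing Implicit Defensive.

Record sgraph := SGraph {
  vertex :> finType;
  adj : rel vertex;
  adj_sym : symmetric adj;
  adj_irrefl : irreflexive adj
}.

Definition edges (G : sgraph) : {set {set G}} :=
  [set [set p.1; p.2] | p : G * G & adj p.1 p.2].

(* Edge labelings are functions on all vertex sets; every notion below only
   looks at their values on [edges G]. *)
Section LocalAntimagic.
Variable G : sgraph.
Implicit Type f : {set G} -> nat.

Definition weight f (v : G) : nat := \sum_(e in edges G | v \in e) f e.

Definition edge_bijection f : Prop :=
  {in edges G &, injective f} /\
  (forall k : nat, (exists2 e, e \in edges G & f e = k) <-> 1 <= k <= #|edges G|).

Definition local_antimagic f : Prop :=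
  edge_bijection f /\ (forall u v : G, adj u v -> weight f u <> weight f v).

Definition num_colors f : nat := size (undup (codom (weight f))).

(* [is_chi_la k] states that the minimum exists and equals [k]: a graph with
   no local antimagic labeling (one with a K_2 component) satisfies it for
   no [k]. *)
Definition is_chi_la (k : nat) : Prop :=
  (exists2 f, local_antimagic f & num_colors f = k) /\
  (forall f, local_antimagic f -> k <= num_colors f).

End LocalAntimagic.

Arguments is_chi_la : clear implicits.

(* [ordS] is the cyclic successor on ['I_n]; the condition [i != j] only
   matters for [n = 1], where it removes the loop. *)
Definition cycle_adj n : rel 'I_n :=
  fun i j => (i != j) && ((j == ordS i) || (i == ordS j)).

Lemma cycle_adj_sym n : symmetric (@cycle_adj n).
Proof. by move=> i j; rewrite /cycle_adj eq_sym orbC. Qed.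

Lemma cycle_adj_irrefl n : irreflexive (@cycle_adj n).
Proof. by move=> i; rewrite /cycle_adj eqxx. Qed.

Definition cycle_graph n : sgraph :=
  SGraph (@cycle_adj_sym n) (@cycle_adj_irrefl n).

Definition complete_adj n : rel 'I_n := fun i j => i != j.

Lemma complete_adj_sym n : symmetric (@complete_adj n).
Proof. by move=> i j; rewrite /complete_adj eq_sym. Qed.

Lemma complete_adj_irrefl n : irreflexive (@complete_adj n).
Proof. by move=> i; rewrite /complete_adj eqxx. Qed.

Definition complete_graph n : sgraph :=
  SGraph (@complete_adj_sym n) (@complete_adj_irrefl n).

Section Corona.
Variables G H : sgraph.

(* [inr (x, y)] is the vertex [y] of the copy of [H] attached to [x]. *)
Definition corona_adj : rel (G + G * H)%type := fun a b =>
  match a, b with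
  | inl x, inl x' => adj x x'
  | inl x, inr (x', _) => x == x'
  | inr (x, _), inl x' => x == x'
  | inr (x, y), inr (x', y') => (x == x') && adj y y'
  end.

Lemma corona_adj_sym : symmetric corona_adj.
Proof.
move=> [x|[x y]] [x'|[x' y']] /=; first exact: adj_sym.
- exact: eq_sym.
- exact: eq_sym.
- by rewrite eq_sym adj_sym.
Qed.

Lemma corona_adj_irrefl : irreflexive corona_adj.
Proof. by move=> [x|[x y]] /=; rewrite adj_irrefl ?andbF. Qed.

Definition corona : sgraph := SGraph corona_adj_sym corona_adj_irrefl.

End Corona.

(* Main.v *)
(** Write c_i for the label of the cycle edge from v_i to v_(i+1) and p_i for
    that of the pendant edge at v_i; the pendant vertices have the n distinct
    weights p_i <= 2n.  With at most n+1 colors, all cycle vertices of weight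
    above 2n share one color, hence are pairwise non-adjacent, and every cycle
    edge has an end of weight at most 2n.  Summing the weights of these light
    vertices, and p_i <= 2n over the others, bounds the sum n(2n+1) of all
    labels by 2n^2, which is absurd.

    Conversely, labeling the cycle edges 1, m+2, 2, m+3, ... for n = 2m+1 (or
    2, m+2, 3, m+3, ... for n = 2m) makes the sums c_(i-1) + c_i consecutive,
    so pendant labels taken from the top block of labels, paired as M-1, M,
    M-3, M-2, ..., give the cycle vertices two alternating weights A and A+2.
    Only the vertex where the cycle closes (two vertices for even n, next to
    an edge labeled 1) escapes the pattern; it receives the weight of some
    pendant vertex. This leaves out n = 4, where the two escaping weights do
    not fit below 2n. *)

Require Import Defs.
From mathcomp Require Import all_boot.
From mathcomp Require Import zify.
Set Implicit Arguments.
Unset Strict Implicit.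
Unset Printing Implicit Defensive.

(** * Edges and vertex weights of the sun graph *)

Definition sun n : sgraph := corona (cycle_graph n) (complete_graph 1).

Definition rim n (i : 'I_n) : sun n := inl i.
Definition tip n (i : 'I_n) : sun n := inr (i, ord0).

(* [inl i] indexes the cycle edge from [i] to its successor, [inr i] the
   pendant edge at [i]. *)
Definition sun_edge n (x : 'I_n + 'I_n) : {set sun n} :=
  match x with
  | inl i => [set rim i; rim (ordS i)]
  | inr i => [set rim i; tip i]
  end.
Arguments sun_edge : simpl never.

Section Sun.
Variable n : nat.
Hypothesis n_gt2 : 2 < n.

Lemma val_ordS (i : 'I_n) : ordS i = (if i.+1 == n then 0 else i.+1) :> nat.
Proof.
rewrite /=; case: eqP => [->|ne]; first exact: modnn.
by rewrite modn_small // ltn_neqAle ltn_ord andbT; apply/eqP.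
Qed.

Lemma val_ord_pred (i : 'I_n) :
  ord_pred i = (if i == 0 :> nat then n.-1 else i.-1) :> nat.
Proof.
have := congr1 (@nat_of_ord n) (ord_predK i); rewrite val_ordS.
have := ltn_ord i; have := ltn_ord (ord_pred i).
by case: eqP; case: eqP; lia.
Qed.

Lemma ordS_neq (i : 'I_n) : (ordS i == i) = false.
Proof.
by apply/eqP => /(congr1 (@nat_of_ord n)); rewrite val_ordS; case: ifP; lia.
Qed.

(** This is where [n > 2] matters: on two vertices both cycle edges would be the same vertex set. *)
Lemma ordSS_neq (i : 'I_n) : (ordS (ordS i) == i) = false.
Proof.
apply/eqP => /(congr1 (@nat_of_ord n)); rewrite !val_ordS.
by have := ltn_ord i; do 2?case: ifP; lia.
Qed.

Lemma tip_eq (i j : 'I_n) : (tip i == tip j) = (i == j).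
Proof. by rewrite /tip /eq_op /= -pair_eqE /= eqxx andbT. Qed.

Lemma rim_in_edge (i : 'I_n) x :
  (rim i \in sun_edge x) =
  match x with inl j => (i == j) || (i == ordS j) | inr j => i == j end.
Proof. by case: x => j; rewrite /sun_edge !inE ?orbF. Qed.

Lemma tip_in_edge (i : 'I_n) x :
  (tip i \in sun_edge x) = (if x is inr j then i == j else false).
Proof. by case: x => j; rewrite /sun_edge !inE // tip_eq. Qed.

Lemma sun_edge_inj : injective (@sun_edge n).
Proof.
move=> x y /setP eq_xy.
case: x y eq_xy => i [] j eq_xy.
- have := eq_xy (rim i); rewrite !rim_in_edge eqxx /=.
  case: eqP => [-> //|_] /= /esym/eqP ij.
  have := eq_xy (rim j); rewrite !rim_in_edge eqxx /= ij eq_sym ordS_neq /=.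
  by rewrite eq_sym ordSS_neq.
- by have := eq_xy (tip j); rewrite !tip_in_edge eqxx.
- by have := eq_xy (tip i); rewrite !tip_in_edge eqxx.
- by have := eq_xy (tip i); rewrite !tip_in_edge eqxx => /esym/eqP ->.
Qed.

Lemma edges_sun : edges (sun n) = [set sun_edge x | x : 'I_n + 'I_n].
Proof.
apply/setP => e; apply/imsetP/imsetP => [[[u v] /= + ->]|[x _ ->]].
- rewrite inE /=; case: u v => [i|[i u]] [j|[j v]] /=.
  + case/andP => _ /orP[]/eqP->; first by exists (inl i).
    by exists (inl j); rewrite // /sun_edge setUC.
  + by move/eqP->; exists (inr j); rewrite // /sun_edge /tip (ord1 v).
  + by move/eqP->; exists (inr j); rewrite // /sun_edge /tip (ord1 u) setUC.
  + by rewrite (ord1 u) (ord1 v) andbF.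
- case: x => i.
  + exists (rim i, rim (ordS i)) => //.
    by rewrite inE /= /cycle_adj eq_sym ordS_neq eqxx.
  + by exists (rim i, tip i) => //; rewrite inE /=.
Qed.

Lemma card_edges_sun : #|edges (sun n)| = n.*2.
Proof.
rewrite edges_sun card_imset; last exact: sun_edge_inj.
by rewrite card_sum card_ord addnn.
Qed.

Lemma weightE (f : {set sun n} -> nat) v :
  weight f v = \sum_(x | v \in sun_edge x) f (sun_edge x).
Proof.
rewrite /weight edges_sun big_mkcondr /=.
rewrite (big_imset _ (in2W sun_edge_inj)) /= [RHS]big_mkcond /=.
by apply: eq_bigl => x; rewrite inE.
Qed.

Lemma weight_tip (f : {set sun n} -> nat) i :
  weight f (tip i) = f (sun_edge (inr i)).
Proof.
rewrite weightE big_sumType /= big_pred0 => [|j]; last first.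
  exact: (tip_in_edge i (inl j)).
by rewrite add0n (big_pred1 i) // => j; rewrite tip_in_edge eq_sym.
Qed.

Lemma weight_rim (f : {set sun n} -> nat) i :
  weight f (rim i) = f (sun_edge (inr i)) + f (sun_edge (inl i))
    + f (sun_edge (inl (ord_pred i))).
Proof.
rewrite weightE big_sumType /= [X in _ + X](big_pred1 i); last first.
  by move=> j; rewrite rim_in_edge eq_sym.
rewrite (bigD1 i) /=; last by rewrite rim_in_edge eqxx.
rewrite (big_pred1 (ord_pred i)); first by rewrite addnC addnA.
move=> j; rewrite rim_in_edge.
rewrite (eq_sym i (ordS j)) (can2_eq (@ordSK n) (@ord_predK n)) (eq_sym i) /=.
case: (eqVneq j (ord_pred i)) => [->|_]; last by case: (j == i).
by rewrite orbT -{2}(ord_predK i) eq_sym ordS_neq.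
Qed.

(** * Lower bound on the number of colors *)

Lemma sum_labels (f : {set sun n} -> nat) : edge_bijection f ->
  \sum_(i < n) (f (sun_edge (inr i)) + f (sun_edge (inl i))) = n * n.*2.+1.
Proof.
case=> f_inj f_onto.
transitivity (\sum_(e in edges (sun n)) f e).
  rewrite edges_sun (big_imset _ (in2W sun_edge_inj)) big_sumType /= addnC.
  exact: big_split.
have -> : \sum_(e in edges (sun n)) f e = \sum_(1 <= k < n.*2.+1) k.
  rewrite -big_enum -(big_map f predT id) /=; apply: perm_big; apply: uniq_perm.
  - rewrite map_inj_in_uniq ?enum_uniq // => d e.
    by rewrite !mem_enum; apply: f_inj.
  - exact: iota_uniq.
  - move=> k; rewrite mem_index_iota ltnS -card_edges_sun.
    apply/mapP/idP => [[e + ->]|/f_onto[e e_in <-]].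
      by rewrite mem_enum => e_in; apply/f_onto; exists e.
    by exists e; rewrite // mem_enum.
transitivity (\sum_(0 <= k < n.*2.+1) k); first by rewrite [RHS]big_ltn.
by rewrite bin2_sum bin2 /= -doubleMr doubleK mulnC.
Qed.

Lemma num_colors_lower (f : {set sun n} -> nat) :
  local_antimagic f -> n + 2 <= num_colors f.
Proof.
case=> -[f_inj f_onto] f_la.
have edge_in x : sun_edge x \in edges (sun n).
  by rewrite edges_sun; apply: imset_f.
have f_range x : 1 <= f (sun_edge x) <= n.*2.
  by rewrite -card_edges_sun; apply/f_onto; exists (sun_edge x).
pose p i := f (sun_edge (inr i)); pose c i := f (sun_edge (inl i)).
have p_inj : injective p.
  move=> i j /(f_inj _ _ (edge_in _) (edge_in _)).
  by case/(@sun_edge_inj (inr i) (inr j)).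
pose w i := weight f (rim i).
have [[i wi wSi] | heavy_indep] :
    (exists2 i, n.*2 < w i & n.*2 < w (ordS i)) \/
    (forall i, (w i <= n.*2) || (w (ordS i) <= n.*2)).
  case: (boolP [forall i, (w i <= n.*2) || (w (ordS i) <= n.*2)]).
    by move/forallP; right.
  rewrite negb_forall => /existsP[i]; rewrite negb_or -!ltnNge => /andP[wi wSi].
  by left; exists i.
(* Two adjacent heavy vertices have distinct weights, both above the [n] distinct pendant labels. *)
- have -> : n + 2 = size ([:: w i; w (ordS i)] ++ codom p).
    by rewrite size_cat size_codom card_ord addnC.
  apply: uniq_leq_size => [|k].
    rewrite cat_uniq (map_inj_uniq p_inj) enum_uniq andbT /= inE andbT.
    apply/andP; split.
      apply/eqP; apply: f_la.
      by rewrite /= /cycle_adj eq_sym ordS_neq eqxx.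
    rewrite -all_predC; apply/allP => _ /codomP[j ->] /=; rewrite !inE.
    by have := f_range (inr j); rewrite -/(p j); lia.
  rewrite mem_undup mem_cat !inE -orbA => /or3P[/eqP->|/eqP->|/codomP[j ->]].
  + exact: codom_f.
  + exact: codom_f.
  + by rewrite -[p j](weight_tip f j); apply: codom_f.
- have wE i : w i = p i + c i + c (ord_pred i) by apply: weight_rim.
  have : \sum_(i < n) (p i + c i) <= \sum_(i < n) n.*2.
    pose l i := w i <= n.*2.
    (* Each cycle edge has a light end, so charging its label to its light ends loses nothing. *)
    have c_le i : c i <= l i * c i + l (ordS i) * c i.
      have := heavy_indep i; rewrite -/(l i) -/(l (ordS i)).
      by case: (l i); case: (l (ordS i)); lia.
    (* A light vertex is charged its whole weight, a heavy one only its pendant label. *)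
    have p_le i : p i + (l i * c i + l i * c (ord_pred i)) <= n.*2.
      have := f_range (inr i); rewrite -/(p i) /l wE.
      by case: leqP; lia.
    apply: leq_trans (leq_sum _ (fun i _ => p_le i)).
    rewrite !big_split /= leq_add2l.
    (* The shift brings together the charges of [c i] at both of its ends. *)
    rewrite [X in _ <= _ + X](reindex_inj (@ordS_inj n)) /=.
    rewrite -big_split; apply: leq_sum => i _ /=.
    by rewrite ordSK.
  rewrite sum_nat_const card_ord (sum_labels (conj f_inj f_onto)); lia.
Qed.

(** * From label sequences to labelings *)

Definition rim_weight (c p : nat -> nat) i :=
  p i + c i + c (if i == 0 then n.-1 else i.-1).

(** The colors are the [n] pendant labels, [A] and [B]; any other cycle weight must repeat a pendant
    label. Sequences over [nat] turn all conditions into arithmetic. *)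
Lemma is_chi_la_sun (c p : nat -> nat) (A B : nat) :
    (forall i, i < n -> 0 < c i <= n.*2 /\ 0 < p i <= n.*2) ->
    (forall i j, i < n -> j < n -> c i = c j -> i = j) ->
    (forall i j, i < n -> j < n -> p i = p j -> i = j) ->
    (forall i j, i < n -> j < n -> c i <> p j) ->
    (forall i, i < n ->
       rim_weight c p i <> rim_weight c p (if i.+1 == n then 0 else i.+1)) ->
    (forall i, i < n -> [\/ rim_weight c p i = A, rim_weight c p i = B
       | exists2 j, j < n & rim_weight c p i = p j]) ->
  is_chi_la (sun n) (n + 2).
Proof.
move=> cp_range c_inj p_inj cp_neq w_neq w_col.
pose l (x : 'I_n + 'I_n) := match x with inl i => c i | inr i => p i end.
have l_range x : 0 < l x <= n.*2 by case: x => i; case: (cp_range i).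
have l_inj : injective l.
  case=> i [] j /= eq_l.
  - by rewrite (val_inj (c_inj _ _ (ltn_ord i) (ltn_ord j) eq_l)).
  - by case: (cp_neq i j (ltn_ord i) (ltn_ord j) eq_l).
  - by case: (cp_neq j i (ltn_ord j) (ltn_ord i) (esym eq_l)).
  - by rewrite (val_inj (p_inj _ _ (ltn_ord i) (ltn_ord j) eq_l)).
pose f (e : {set sun n}) :=
  if [pick x | sun_edge x == e] is Some x then l x else 0.
have fE x : f (sun_edge x) = l x.
  rewrite /f; case: pickP => [y /eqP/sun_edge_inj -> //|/(_ x)].
  by rewrite eqxx.
have w_rim i : weight f (rim i) = rim_weight c p i.
  by rewrite weight_rim !fE /rim_weight -val_ord_pred.
have w_tip i : weight f (tip i) = p i by rewrite weight_tip fE.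
have f_la : local_antimagic f.
  split; first split.
  - move=> d e; rewrite edges_sun => /imsetP[x _ ->] /imsetP[y _ ->].
    by rewrite !fE => /l_inj ->.
  - move=> k; rewrite card_edges_sun; split.
      by rewrite edges_sun => -[_ /imsetP[x _ ->] <-]; rewrite fE.
    move=> k_range.
    (* Surjectivity by counting: [2n] distinct labels lie in a range of size [2n]. *)
    have l_onto : k \in codom l.
      have l_uniq : uniq (codom l) by rewrite (map_inj_uniq l_inj) enum_uniq.
      have l_sub : {subset codom l <= iota 1 n.*2}.
        by move=> _ /codomP[x ->]; rewrite mem_iota; apply: l_range.
      have [|_ ->] := uniq_min_size l_uniq l_sub.
        by rewrite size_codom card_sum card_ord size_iota addnn.
      by rewrite mem_iota.
    have /codomP[x ->] := l_onto.
    by exists (sun_edge x); rewrite ?edges_sun ?imset_f ?fE.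
  (* A cycle vertex outweighs its pendant neighbor by two positive cycle labels. *)
  have tip_rim i : weight f (tip i) <> weight f (rim i).
    rewrite w_tip w_rim /rim_weight; have [] := cp_range i (ltn_ord i); lia.
  have rim_rim i : weight f (rim i) <> weight f (rim (ordS i)).
    by rewrite !w_rim val_ordS; apply: w_neq.
  case=> [i|[i u]] [j|[j v]] /=.
  - by case/andP => _ /orP[]/eqP ->; [|apply: nesym]; apply: rim_rim.
  - by move/eqP <-; rewrite (ord1 v); apply: nesym; apply: tip_rim.
  - by move/eqP ->; rewrite (ord1 u); apply: tip_rim.
  - by rewrite (ord1 u) (ord1 v) andbF.
split; last exact: num_colors_lower.
exists f => //; apply/eqP; rewrite eqn_leq num_colors_lower // andbT.
have -> : n + 2 = size ([:: A; B] ++ [seq p i | i <- iota 0 n]).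
  by rewrite size_cat size_map size_iota addnC.
apply: uniq_leq_size (undup_uniq _) _ => k.
have p_in i : i < n -> p i \in [seq p i | i <- iota 0 n].
  by move=> lt_i; apply: map_f; rewrite mem_iota.
rewrite mem_undup => /codomP[[i|[i u]] ->]; rewrite mem_cat !inE.
- rewrite [weight _ _]w_rim; have [->|->|[j lt_j ->]] := w_col i (ltn_ord i).
  + by rewrite eqxx.
  + by rewrite eqxx orbT.
  + by rewrite p_in // orbT.
- by rewrite (ord1 u) [weight _ _]w_tip p_in ?orbT.
Qed.

End Sun.

(** * Explicit labelings *)

Lemma is_chi_la_sun4 : is_chi_la (sun 4) 6.
Proof.
apply: (@is_chi_la_sun 4 isT
  (nth 0 [:: 1; 2; 3; 5]) (nth 0 [:: 6; 4; 7; 8]) 12 16).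
- by do 4?[case=> //].
- by do 4?[case=> //]; do 4?[case=> //].
- by do 4?[case=> //]; do 4?[case=> //].
- by do 4?[case=> //]; do 4?[case=> //].
- by do 4?[case=> //].
(* The cycle weights are 12, 7, 12, 16, and 7 is the pendant label at vertex 2. *)
- do 4?[case=> //] => _.
  + by constructor 1.
  + by constructor 3; exists 2.
  + by constructor 1.
  + by constructor 2.
Qed.

(** For [i > 0] the two cycle labels at [i] add up to [m + 2 + i], and [p i] cancels the [i]. *)
Lemma is_chi_la_sun_odd m : 1 < m -> is_chi_la (sun m.*2.+1) (m.*2.+1 + 2).
Proof.
move=> m_gt1.
apply: (@is_chi_la_sun _ _
  (fun i => if odd i then m + 2 + i./2 else i./2.+1)
  (fun i => if i == 0 then m.*2 + 2
            else if odd i then m * 4 + 2 - i else m * 4 + 4 - i)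
  (m * 5 + 4) (m * 5 + 6)).
- lia.
- by move=> i; case: ifP; case: ifP; lia.
- by move=> i j; case: ifP; case: ifP; lia.
- by move=> i j; do !case: ifP; lia.
- by move=> i j; do !case: ifP; lia.
- by move=> i; rewrite /rim_weight; do !case: ifP; rewrite /=; lia.
- move=> i lt_i; rewrite /rim_weight.
  case: (posnP i) => [->|i_gt0].
    (* Vertex 0 weighs [3m + 4]; solving [p j = 3m + 4] gives [m - 2] for odd [j] and [m] for even
       [j]. *)
    constructor 3; exists (if odd m then m - 2 else m); first by case: ifP; lia.
    by do !case: ifP; rewrite /=; lia.
  case: (boolP (odd i)) => odd_i; [constructor 1|constructor 2];
    do !case: ifP; lia.
Qed.

(** Away from both ends of the edge labeled 1, the cycle labels at [i] add up to [m + 3 + i]. *)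
Lemma is_chi_la_sun_even m : 2 < m -> is_chi_la (sun m.*2) (m.*2 + 2).
Proof.
move=> m_gt2.
apply: (@is_chi_la_sun _ _
  (fun i => if i == m.*2.-1 then 1
            else if odd i then m + 2 + i./2 else i./2.+2)
  (fun i => if i == 0 then m.*2 + 2 else if i == m.*2.-1 then m.*2.+1
            else if odd i then m * 4 - i else m * 4 + 2 - i)
  (m * 5 + 3) (m * 5 + 5)).
- lia.
- by move=> i; do !case: ifP; lia.
- by move=> i j; do !case: ifP; lia.
- by move=> i j; do !case: ifP; lia.
- by move=> i j; do !case: ifP; lia.
- by move=> i; rewrite /rim_weight; do !case: ifP; rewrite /=; lia.
- move=> i lt_i; rewrite /rim_weight.
  case: (posnP i) => [->|i_gt0].
    (* Vertex 0 weighs [2m + 5], the pendant label at the odd index [2m - 5], positive as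
       [m > 2]. *)
    constructor 3; exists (m.*2 - 5); first lia.
    by do !case: ifP; rewrite /=; lia.
  case: (eqVneq i m.*2.-1) => [->|i_neq].
    (* The last vertex weighs [3m + 3], which is [p j] for even [j = m - 1] or odd [j = m - 3]. *)
    constructor 3; exists (if odd m then m.-1 else m - 3).
      by case: ifP; lia.
    by do !case: ifP; rewrite /=; lia.
  case: (boolP (odd i)) => odd_i; [constructor 1|constructor 2];
    do !case: ifP; lia.
Qed.

Theorem theorem3p5 (n : nat) (hn : 4 <= n) :
  is_chi_la (corona (cycle_graph n) (complete_graph 1)) (n + 2).
Proof.
rewrite -/(sun n); rewrite -(odd_double_half n) in hn *.
case: (odd n) hn => /= hn; first by apply: is_chi_la_sun_odd; lia.
case: (eqVneq n./2 2) => [->|n_neq4]; first exact: is_chi_la_sun4.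
by apply: is_chi_la_sun_even; lia.
Qed.
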